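(* Let $R$ be either $3A_1\oplus A_2\oplus A_4$ or $4A_1\oplus A_5$. Then $R$ admits an isometric embedding into neither $I_{1,9}=\langle1\rangle\oplus 9\langle-1\rangle$ nor $II_{1,9}=H\oplus E_8$. In particular, there is no rational homology projective plane $S$ with only cyclic quotient singularities, $K_S$ nef and exactly $5$ singular points, whose minimal resolution $f:S'\to S$ has exceptional lattice $R$ isomorphic to $3A_1\oplus A_2\oplus A_4$ or to $4A_1\oplus A_5$.
   Context: $A_n$, $E_8$ denote the negative definite root lattices; $H$ is the even unimodular lattice of signature $(1,1)$; $\langle k\rangle$ is the rank one lattice with generator of square $k$. A rational homology projective plane is a normal projective complex surface with the same Betti numbers as $\mathbb{CP}^2$. The exceptional lattice $R$ is the sublattice of $H^2(S',\mathbb{Z})/\mathrm{torsion}$ (cup product) spanned by the classes of all irreducible exceptional curves of $f$. *)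

(* Defs.v *)
(* Lattices are given by integer Gram matrices in a Z-basis. *)
From mathcomp Require Import all_boot all_order all_algebra.
Set Implicit Arguments. Unset Strict Implicit. Unset Printing Implicit Defensive.
Import GRing.Theory Num.Theory.
Local Open Scope ring_scope.

Definition dsum (m n : nat) (A : 'M[int]_m) (B : 'M[int]_n) : 'M[int]_(m + n) :=
  block_mx A 0 0 B.

Definition A_lat (n : nat) : 'M[int]_n :=
  \matrix_(i, j) (if i == j then (- 2%:Z)
                  else if (i.+1 == j :> nat) || (j.+1 == i :> nat) then 1%:Z else 0%:Z).

(* Dynkin diagram of E_8 (Bourbaki labelling 1..8, here shifted to 0..7):
   chain 1-3-4-5-6-7-8 with 2 attached to 4. *)
Definition E8_edge (i j : nat) : bool :=
  [|| (i == 0) && (j == 2), (i == 2) && (j == 3), (i == 3) && (j == 4),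
      (i == 4) && (j == 5), (i == 5) && (j == 6), (i == 6) && (j == 7)
    | (i == 1) && (j == 3)]%N.

Definition E8_lat : 'M[int]_8 :=
  \matrix_(i, j) (if i == j then (- 2%:Z)
                  else if E8_edge i j || E8_edge j i then 1%:Z else 0%:Z).

Definition H_lat : 'M[int]_2 :=
  \matrix_(i, j) (if i == j then 0%:Z else 1%:Z).

Definition rk1 (k : int) : 'M[int]_1 := k%:M.

Definition I_1_9 : 'M[int]_(1 + 9) := dsum (rk1 1) (- (1%:M : 'M[int]_9)).

Definition II_1_9 : 'M[int]_(2 + 8) := dsum H_lat E8_lat.

Definition R1 : 'M[int]_(1 + 1 + 1 + 2 + 4) :=
  dsum (dsum (dsum (dsum (A_lat 1) (A_lat 1)) (A_lat 1)) (A_lat 2)) (A_lat 4).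

Definition R2 : 'M[int]_(1 + 1 + 1 + 1 + 5) :=
  dsum (dsum (dsum (dsum (A_lat 1) (A_lat 1)) (A_lat 1)) (A_lat 1)) (A_lat 5).

(* Isometric embedding of the lattice with Gram matrix A into the one with Gram
   matrix B: an injective Z-linear map (row i of M = image of i-th basis vector)
   preserving the bilinear forms. *)
Definition isometric_embedding (m n : nat) (A : 'M[int]_m) (B : 'M[int]_n) : Prop :=
  exists M : 'M[int]_(m, n),
    M *m B *m M^T = A /\ (forall v : 'rV[int]_m, v *m M = 0 -> v = 0).

(* Main.v *)
Require Import Defs.
From mathcomp Require Import all_boot all_order all_algebra.
Set Implicit Arguments. Unset Strict Implicit. Unset Printing Implicit Defensive.
Import GRing.Theory.
Local Open Scope ring_scope.

(* Reduce modulo 3.  For L = I_{1,9} or II_{1,9}, L/3L is a nondegenerate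
   quadratic space over F_3 of discriminant -1.  For each R in question there
   is z in R with z/3 in the dual of R and 9 not dividing z^2, and R/3R is the
   orthogonal sum of the radical spanned by z and a nondegenerate space W of
   discriminant 2.  Under an embedding R -> L the image x of z in L/3L is
   nonzero (otherwise z = 3w in L and 9 divides z^2), isotropic and orthogonal
   to W.  Completing x to a hyperbolic plane orthogonal to W shows that the
   discriminant of L/3L is -disc W = 1 modulo squares; but -1 is not a square
   in F_3. *)

Lemma det_mx2 (R : comPzRingType) (A : 'M[R]_(1 + 1)) :
  \det A = A (lshift 1 0) (lshift 1 0) * A (rshift 1 0) (rshift 1 0)
         - A (lshift 1 0) (rshift 1 0) * A (rshift 1 0) (lshift 1 0).
Proof.
rewrite (expand_det_row _ (lshift 1 0)) !big_ord_recl big_ord0 addr0 /cofactor.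
rewrite !det_mx11 !mxE /= expr0 expr1 !mul1r mulN1r mulrN.
by congr (A _ _ * A _ _ - A _ _ * A _ _); apply/val_inj.
Qed.

Lemma det_block_mx11 (R : comPzRingType) (a b c d : R) :
  \det (block_mx a%:M b%:M c%:M d%:M : 'M_(1 + 1)) = a * d - b * c.
Proof. by rewrite det_mx2 block_mxEul block_mxEur block_mxEdl block_mxEdr !mxE. Qed.

Lemma det_form (R : comPzRingType) n (G P : 'M[R]_n) :
  \det (P *m G *m P^T) = \det P ^+ 2 * \det G.
Proof. by rewrite !det_mulmx det_tr expr2 mulrAC. Qed.

Lemma det_form_sqr_ratio (F : fieldType) n (G P Q : 'M[F]_n) :
  \det (P *m G *m P^T) != 0 ->
  \det (Q *m G *m Q^T) = (\det Q / \det P) ^+ 2 * \det (P *m G *m P^T).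
Proof.
rewrite !det_form mulf_eq0 negb_or expf_eq0 /= => /andP[detP _].
by rewrite expr_div_n mulrA divfK // expf_neq0.
Qed.

Section IsotropicComplement.

Variables (F : fieldType) (k : nat) (G : 'M[F]_(k.+2)).
Hypotheses (G_sym : G^T = G) (G_unit : G \in unitmx).
Variables (x : 'rV[F]_(k.+2)) (W : 'M[F]_(k, k.+2)).
Hypotheses (x_neq0 : x != 0) (x_iso : x *m G *m x^T = 0).
Hypotheses (xW_orth : x *m G *m W^T = 0) (W_unit : W *m G *m W^T \in unitmx).

Lemma trmx_form m1 m2 (U : 'M_(m1, k.+2)) (V : 'M_(m2, k.+2)) :
  (U *m G *m V^T)^T = V *m G *m U^T.
Proof. by rewrite !trmx_mul trmxK G_sym mulmxA. Qed.

Lemma row_free_isotropic_complement : row_free (col_mx x W).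
Proof.
apply/inj_row_free => v; rewrite -[v]hsubmxK mul_row_col => vQ0.
have vr0 : rsubmx v = 0.
  have : (lsubmx v *m x + rsubmx v *m W) *m G *m W^T = 0 by rewrite vQ0 !mul0mx.
  rewrite !mulmxDl -!mulmxA (mulmxA x) (mulmxA W) xW_orth mulmx0 add0r => rWGW0.
  by rewrite -[rsubmx v](mulmxK W_unit) rWGW0 mul0mx.
move: vQ0; rewrite vr0 mul0mx addr0 [lsubmx v]mx11_scalar mul_scalar_mx => /eqP.
by rewrite scalemx_eq0 (negbTE x_neq0) orbF => /eqP->; rewrite raddf0 row_mx0.
Qed.

Lemma exists_isotropic_dual : exists y, y *m G *m x^T = 1 /\ y *m G *m W^T = 0.
Proof.
have full : row_full (G *m (col_mx x W)^T).
  rewrite /row_full -mxrank_tr trmx_mul trmxK.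
  rewrite mxrankMfree ?row_free_unit ?unitmx_tr //.
  exact: row_free_isotropic_complement.
have [y] := submxP (submx_full (row_mx (1 : 'M_1) (0 : 'M_(1, k))) full).
rewrite (tr_col_mx x W) !mul_mx_row => /eq_row_mx[yx yW].
by exists y; rewrite -!mulmxA -yx -yW.
Qed.

Lemma det_form_isotropic_complement :
  exists P : 'M_(k.+2), \det (P *m G *m P^T) = - \det (W *m G *m W^T).
Proof.
have [y [yx yW]] := exists_isotropic_dual.
have Wxy : W *m G *m (col_mx x y)^T = 0.
  by rewrite -trmx_form mul_col_mx mul_col_mx xW_orth yW col_mx0 trmx0.
pose P := col_mx (col_mx x y) W.
suff detP : \det (P *m G *m P^T) = - \det (W *m G *m W^T) by exists P.
rewrite tr_col_mx mul_col_mx mul_col_row Wxy det_ublock tr_col_mx mul_col_mx.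
rewrite !mul_col_row x_iso (mx11_scalar (y *m G *m y^T)) yx -(trmx_form y x) yx trmx1.
by rewrite -(raddf0 (@scalar_mx F 1)) det_block_mx11 mul0r sub0r mul1r mulN1r.
Qed.

End IsotropicComplement.

Lemma Fp3_sqr_neqN1 (a : 'F_3) : a ^+ 2 != -1.
Proof. by case: a => [[|[|[|?]]] ?]. Qed.

Lemma sqr_dvdz_form (p : int) n (G : 'M[int]_n) (w : 'rV[int]_n) :
  (forall j, (p %| w ord0 j)%Z) -> (p * p %| (w *m G *m w^T) ord0 ord0)%Z.
Proof.
move=> p_w; pose v := map_mx (fun a => (a %/ p)%Z) w.
have -> : w = p *: v by apply/matrixP => i j; rewrite ord1 !mxE mulrC divzK.
by rewrite -!scalemxAl linearZ -scalemxAr scalerA mxE dvdz_mulr.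
Qed.

Local Notation mod3 := (map_mx (@intmul 'F_3 1)).

Lemma mod3_eq0_dvdz m n (A : 'M[int]_(m, n)) :
  mod3 A = 0 -> forall i j, (3 %| A i j)%Z.
Proof.
move=> /matrixP A0 i j; rewrite (dvdz_pcharf (pchar_Fp (isT : prime 3))).
by have := A0 i j; rewrite !mxE => ->.
Qed.

Lemma no_isometric_embedding_mod3 k m (R : 'M[int]_m) (L : 'M[int]_(k.+2))
    (z : 'rV[int]_m) (T : 'M[int]_(k, m)) :
  L^T = L ->
  (exists P0 : 'M[int]_(k.+2), \det (mod3 (P0 *m L *m P0^T)) = -1) ->
  mod3 (z *m R) = 0 -> ~~ (9 %| (z *m R *m z^T) ord0 ord0)%Z ->
  \det (mod3 (T *m R *m T^T)) = 2 ->
  ~ isometric_embedding R L.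
Proof.
move=> L_sym [P0 discL] zR0 zRz detT [M [MLM _]].
have G_sym : (mod3 L)^T = mod3 L by rewrite map_trmx L_sym.
set G := mod3 L.
have mod3_form m1 m2 (U : 'M_(m1, m)) (V : 'M_(m2, m)) :
    U *m mod3 M *m G *m (V *m mod3 M)^T = U *m mod3 R *m V^T.
  by rewrite -MLM !map_mxM -map_trmx trmx_mul !mulmxA.
set x := mod3 z *m mod3 M; set W := mod3 T *m mod3 M.
have x_neq0 : x != 0.
  apply: contra zRz => /eqP; rewrite /x -map_mxM => /mod3_eq0_dvdz zM3.
  rewrite -MLM !mulmxA -mulmxA -trmx_mul.
  exact: (sqr_dvdz_form _ (zM3 ord0)).
have x_iso : x *m G *m x^T = 0 by rewrite mod3_form -map_mxM zR0 !mul0mx.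
have xW_orth : x *m G *m W^T = 0 by rewrite mod3_form -map_mxM zR0 !mul0mx.
have detW : \det (W *m G *m W^T) = 2 by rewrite mod3_form map_trmx -!map_mxM.
rewrite !map_mxM -map_trmx in discL.
have : mod3 P0 *m G *m (mod3 P0)^T \in unitmx.
  by rewrite unitmxE discL unitfE oppr_eq0 oner_neq0.
rewrite !unitmx_mul => /andP[/andP[_ G_unit] _].
have W_unit : W *m G *m W^T \in unitmx by rewrite unitmxE unitfE detW.
have [P] := det_form_isotropic_complement G_sym G_unit x_neq0 x_iso xW_orth W_unit.
have opp2_F3 : - 2 = 1 :> 'F_3 by apply/eqP.
rewrite detW opp2_F3 => detP.
have detP_neq0 : \det (P *m G *m P^T) != 0 by rewrite detP oner_neq0.
have := det_form_sqr_ratio (mod3 P0) detP_neq0.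
rewrite detP discL mulr1 => /esym/eqP.
by rewrite (negbTE (Fp3_sqr_neqN1 _)).
Qed.

(* Matrices presented by functions on nat, so that the certificates below can
   be checked by [vm_compute], which cannot see through [\matrix_] or the big
   operators. *)
Definition nat_mx {R : Type} m n (f : nat -> nat -> R) : 'M[R]_(m, n) :=
  \matrix_(i, j) f i j.

Definition seq_mx {R : nmodType} m n (s : seq (seq R)) : 'M[R]_(m, n) :=
  nat_mx m n (fun i j => nth 0 (nth [::] s i) j).

Definition seq_row {R : nmodType} n (s : seq R) : 'rV[R]_n := seq_mx 1 n [:: s].

Definition foldr_iota {R : Type} (op : R -> R -> R) (idx : R) n (h : nat -> R) : R :=
  foldr (fun k acc => op (h k) acc) idx (iota 0 n).

Definition eq_nat_mxb {R : eqType} m n (f g : nat -> nat -> R) : bool :=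
  all (fun i => all (fun j => f i j == g i j) (iota 0 n)) (iota 0 m).

Lemma big_ord_foldr_iota (R : Type) (idx : R) (op : R -> R -> R) n (h : nat -> R) :
  \big[op/idx]_(k < n) h k = foldr_iota op idx n h.
Proof. by rewrite -(big_mkord xpredT h) unlock /index_iota subn0. Qed.

Lemma eq_nat_mx (R : eqType) m n (f g : nat -> nat -> R) :
  eq_nat_mxb m n f g -> nat_mx m n f = nat_mx m n g.
Proof.
move=> /allP fg; apply/matrixP => i j; rewrite !mxE.
have /fg /allP fg_i : val i \in iota 0 m by rewrite mem_iota ltn_ord.
by apply/eqP/fg_i; rewrite mem_iota ltn_ord.
Qed.

Lemma nat_mx0 (R : nmodType) m n : nat_mx m n (fun _ _ => 0 : R) = 0.
Proof. by apply/matrixP => i j; rewrite !mxE. Qed.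

Lemma scalar_nat_mx (R : pzSemiRingType) n (a : R) :
  a%:M = nat_mx n n (fun i j => if i == j then a else 0).
Proof.
by apply/matrixP => i j; rewrite !mxE -[nat_of_ord i == _]/(i == j); case: (i == j).
Qed.

Lemma opp_nat_mx (R : zmodType) m n (f : nat -> nat -> R) :
  - nat_mx m n f = nat_mx m n (fun i j => - f i j).
Proof. by apply/matrixP => i j; rewrite !mxE. Qed.

Lemma tr_nat_mx (R : Type) m n (f : nat -> nat -> R) :
  (nat_mx m n f)^T = nat_mx n m (fun i j => f j i).
Proof. by apply/matrixP => i j; rewrite !mxE. Qed.

Lemma map_nat_mx (R S : Type) (phi : R -> S) m n (f : nat -> nat -> R) :
  map_mx phi (nat_mx m n f) = nat_mx m n (fun i j => phi (f i j)).
Proof. by apply/matrixP => i j; rewrite !mxE. Qed.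

Lemma mul_nat_mx (R : pzSemiRingType) m n p (f g : nat -> nat -> R) :
  nat_mx m n f *m nat_mx n p g =
  nat_mx m p (fun i j => foldr_iota +%R 0 n (fun k => f i k * g k j)).
Proof.
apply/matrixP => i j; rewrite !mxE -big_ord_foldr_iota.
by apply: eq_bigr => k _; rewrite !mxE.
Qed.

Lemma dsum_nat_mx m n (f g : nat -> nat -> int) :
  dsum (nat_mx m m f) (nat_mx n n g) =
  nat_mx (m + n) (m + n) (fun i j =>
    if (i < m)%N then (if (j < m)%N then f i j else 0)
    else if (j < m)%N then 0 else g (i - m)%N (j - m)%N).
Proof.
apply/matrixP => i j; rewrite /dsum /nat_mx !mxE.
case: splitP => i' ->; rewrite !mxE; case: splitP => j' Ej; by rewrite !mxE ?Ej ?addKn.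
Qed.

Lemma diag_nat_mx (R : nmodType) n (f : nat -> nat -> R) :
  diag_mx (nat_mx 1 n f) = nat_mx n n (fun i j => if i == j then f 0%N i else 0).
Proof.
by apply/matrixP => i j; rewrite !mxE -[nat_of_ord i == _]/(i == j); case: (i == j).
Qed.

Lemma det_diag_nat_mx (R : comPzRingType) n (f : nat -> nat -> R) :
  \det (diag_mx (nat_mx 1 n f)) = foldr_iota *%R 1 n (f 0%N).
Proof.
by rewrite det_diag -big_ord_foldr_iota; apply: eq_bigr => i _; rewrite mxE.
Qed.

Lemma A_lat_nat_mx n : A_lat n = nat_mx n n (fun i j =>
  if i == j then - 2%:Z else if (i.+1 == j) || (j.+1 == i) then 1 else 0).
Proof. by apply/matrixP => i j; rewrite !mxE. Qed.

Lemma E8_lat_nat_mx : E8_lat = nat_mx 8 8 (fun i j =>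
  if i == j then - 2%:Z else if E8_edge i j || E8_edge j i then 1 else 0).
Proof. by apply/matrixP => i j; rewrite !mxE. Qed.

Lemma H_lat_nat_mx : H_lat = nat_mx 2 2 (fun i j => if i == j then 0 else 1).
Proof. by apply/matrixP => i j; rewrite !mxE. Qed.

Ltac nat_mx_simpl :=
  rewrite /seq_row /seq_mx;
  rewrite ?(A_lat_nat_mx, E8_lat_nat_mx, H_lat_nat_mx, scalar_nat_mx, opp_nat_mx,
            dsum_nat_mx, tr_nat_mx, map_nat_mx, mul_nat_mx, diag_nat_mx).

Ltac nat_mx_eval := nat_mx_simpl; apply: eq_nat_mx; vm_compute; reflexivity.

Lemma det_eq_diag_seq_row (R : comPzRingType) n (A : 'M[R]_n) (d : seq R) :
  A = diag_mx (seq_row n d) -> \det A = foldr_iota *%R 1 n (nth 0 d).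
Proof. by move=> ->; rewrite /seq_row /seq_mx det_diag_nat_mx. Qed.

Lemma I_1_9_sym : I_1_9^T = I_1_9.
Proof. rewrite /I_1_9 /rk1; nat_mx_eval. Qed.

Lemma II_1_9_sym : II_1_9^T = II_1_9.
Proof. rewrite /II_1_9; nat_mx_eval. Qed.

Lemma I_1_9_disc_mod3 :
  exists P0 : 'M[int]_10, \det (mod3 (P0 *m I_1_9 *m P0^T)) = -1.
Proof.
exists 1; rewrite mul1mx trmx1 mulmx1.
rewrite (@det_eq_diag_seq_row _ _ _ [:: 1; -1; -1; -1; -1; -1; -1; -1; -1; -1]).
  by apply/eqP.
rewrite /I_1_9 /rk1; nat_mx_eval.
Qed.

Definition P0_II_1_9 : 'M[int]_10 := seq_mx 10 10
  [:: [:: 1; 1; 0; 0; 0; 0; 0; 0; 0; 0]; [:: 1; 2; 0; 0; 0; 0; 0; 0; 0; 0];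
      [:: 0; 0; 1; 0; 0; 0; 0; 0; 0; 0]; [:: 0; 0; 0; 1; 0; 0; 0; 0; 0; 0];
      [:: 0; 0; 0; 0; 0; 0; 1; 0; 0; 0]; [:: 0; 0; 0; 2; 0; 1; 2; 0; 0; 0];
      [:: 0; 0; 2; 2; 1; 1; 2; 0; 0; 0]; [:: 0; 0; 0; 0; 0; 0; 0; 0; 1; 0];
      [:: 0; 0; 2; 0; 1; 0; 2; 1; 2; 0]; [:: 0; 0; 1; 0; 2; 0; 1; 2; 0; 1]].

Lemma II_1_9_disc_mod3 :
  exists P0 : 'M[int]_10, \det (mod3 (P0 *m II_1_9 *m P0^T)) = -1.
Proof.
exists P0_II_1_9.
rewrite (@det_eq_diag_seq_row _ _ _ [:: 2; 1; 1; 1; 1; 2; 1; 1; 2; 1]).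
  by apply/eqP.
rewrite /P0_II_1_9 /II_1_9; nat_mx_eval.
Qed.

(* [z_R / 3] generates the 3-part of the discriminant group of R, the rows of
   [T_R] span a complement of the radical of R/3R on which the form is
   diagonal, and [P0_II_1_9] diagonalizes II_1_9 modulo 3. *)
Definition z_R1 : 'rV[int]_9 := seq_row 9 [:: 0; 0; 0; 1; 2; 0; 0; 0; 0].
Definition z_R2 : 'rV[int]_9 := seq_row 9 [:: 0; 0; 0; 0; 1; 2; 0; 1; 2].

Definition T_R1 : 'M[int]_(8, 9) := seq_mx 8 9
  [:: [:: 1; 0; 0; 0; 0; 0; 0; 0; 0]; [:: 0; 1; 0; 0; 0; 0; 0; 0; 0];
      [:: 0; 0; 1; 0; 0; 0; 0; 0; 0]; [:: 0; 0; 0; 1; 0; 0; 0; 0; 0];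
      [:: 0; 0; 0; 0; 0; 1; 0; 0; 0]; [:: 0; 0; 0; 0; 0; 0; 0; 1; 0];
      [:: 0; 0; 0; 0; 0; 2; 1; 2; 0]; [:: 0; 0; 0; 0; 0; 1; 2; 0; 1]].

Definition T_R2 : 'M[int]_(8, 9) := seq_mx 8 9
  [:: [:: 1; 0; 0; 0; 0; 0; 0; 0; 0]; [:: 0; 1; 0; 0; 0; 0; 0; 0; 0];
      [:: 0; 0; 1; 0; 0; 0; 0; 0; 0]; [:: 0; 0; 0; 1; 0; 0; 0; 0; 0];
      [:: 0; 0; 0; 0; 1; 0; 0; 0; 0]; [:: 0; 0; 0; 0; 0; 0; 1; 0; 0];
      [:: 0; 0; 0; 0; 2; 1; 2; 0; 0]; [:: 0; 0; 0; 0; 1; 2; 0; 1; 0]].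

Lemma R1_radical_mod3 : mod3 (z_R1 *m R1) = 0.
Proof. rewrite -nat_mx0 /z_R1 /R1; nat_mx_eval. Qed.

Lemma R2_radical_mod3 : mod3 (z_R2 *m R2) = 0.
Proof. rewrite -nat_mx0 /z_R2 /R2; nat_mx_eval. Qed.

Lemma R1_norm_z : ~~ (9 %| (z_R1 *m R1 *m z_R1^T) ord0 ord0)%Z.
Proof. rewrite /z_R1 /R1; nat_mx_simpl; rewrite mxE; by vm_compute. Qed.

Lemma R2_norm_z : ~~ (9 %| (z_R2 *m R2 *m z_R2^T) ord0 ord0)%Z.
Proof. rewrite /z_R2 /R2; nat_mx_simpl; rewrite mxE; by vm_compute. Qed.

Lemma R1_disc_mod3 : \det (mod3 (T_R1 *m R1 *m T_R1^T)) = 2.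
Proof.
rewrite (@det_eq_diag_seq_row _ _ _ [:: 1; 1; 1; 1; 1; 1; 2; 1]); first by apply/eqP.
rewrite /T_R1 /R1; nat_mx_eval.
Qed.

Lemma R2_disc_mod3 : \det (mod3 (T_R2 *m R2 *m T_R2^T)) = 2.
Proof.
rewrite (@det_eq_diag_seq_row _ _ _ [:: 1; 1; 1; 1; 1; 1; 2; 1]); first by apply/eqP.
rewrite /T_R2 /R2; nat_mx_eval.
Qed.

Theorem lemma6p8 :
  (~ isometric_embedding R1 I_1_9 /\ ~ isometric_embedding R1 II_1_9) /\
  (~ isometric_embedding R2 I_1_9 /\ ~ isometric_embedding R2 II_1_9).
Proof.
split; split.
- exact: no_isometric_embedding_mod3 I_1_9_sym I_1_9_disc_mod3
    R1_radical_mod3 R1_norm_z R1_disc_mod3.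
- exact: no_isometric_embedding_mod3 II_1_9_sym II_1_9_disc_mod3
    R1_radical_mod3 R1_norm_z R1_disc_mod3.
- exact: no_isometric_embedding_mod3 I_1_9_sym I_1_9_disc_mod3
    R2_radical_mod3 R2_norm_z R2_disc_mod3.
- exact: no_isometric_embedding_mod3 II_1_9_sym II_1_9_disc_mod3
    R2_radical_mod3 R2_norm_z R2_disc_mod3.
Qed.
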